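(* Let $t$ be a closed $\bar\beta_v$-normalizable term. Then for any type derivation $\pi$ with conclusion $\vdash t\colon\mathbf{0}$, $\mathrm{leng}_{\beta_v}(t)=|\pi|$.
   Context: Terms: $t ::= x \mid \lambda x.t \mid tu$ up to $\alpha$-conversion; closed means no free variables; values are variables and abstractions. Balanced contexts: $B ::= [\cdot] \mid (\lambda x.B)t \mid Bt \mid tB$. Root rules: $(\lambda x.t)v \mapsto_{\beta_v} t\{v/x\}$ ($v$ value); $(\lambda x.t)us \mapsto_{\sigma_1} (\lambda x.ts)u$ if $x\notin\mathrm{fv}(s)$; $v((\lambda x.s)u) \mapsto_{\sigma_3} (\lambda x.vs)u$ if $v$ value and $x\notin\mathrm{fv}(v)$. $\to_{\bar\beta_v}$ is the closure of $\mapsto_{\beta_v}$ under balanced contexts, $\to_{\bar\sigma}$ the closure of $\mapsto_{\sigma_1}\cup\mapsto_{\sigma_3}$ under balanced contexts, and $\to_{\bar{\mathsf{sh}}}=\to_{\bar\beta_v}\cup\to_{\bar\sigma}$. $\mathrm{leng}_{\beta_v}(t)$ is the number of $\bar\beta_v$-steps in any $\to_{\bar{\mathsf{sh}}}$-reduction sequence from $t$ to its $\bar{\mathsf{sh}}$-normal form (independent of the sequence), and $\infty$ if there is none. Types: negative $N ::= P\multimap Q$; positive $P,Q ::= [N_1,\dots,N_n]$ finite multisets ($n\ge0$), $\mathbf{0}$ the empty multiset. Environments: maps from variables to positive types, $\mathbf{0}$ almost everywhere; $\uplus$ pointwise multiset sum; $\vdash t\colon P$ means the environment is everywhere $\mathbf{0}$.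 Rules: (ax) $x\colon P\vdash x\colon P$; (@) from $\Gamma\vdash t\colon[P\multimap Q]$ and $\Gamma'\vdash u\colon P$ infer $\Gamma\uplus\Gamma'\vdash tu\colon Q$; ($\lambda$) for $n\ge0$, from $\Gamma_i,x\colon P_i\vdash t\colon Q_i$ ($1\le i\le n$) infer $\biguplus_i\Gamma_i\vdash\lambda x.t\colon[P_1\multimap Q_1,\dots,P_n\multimap Q_n]$. $|\pi|$ is the number of (@) rules in $\pi$. *)

(* Defs.v *)
From HB Require Import structures.
From Stdlib Require Import Relation_Operators.
From mathcomp Require Import all_boot finmap multiset.

Set Implicit Arguments.
Unset Strict Implicit.
Unset Printing Implicit Defensive.

Local Open Scope mset_scope.

(** * Terms *)

(** Terms up to alpha-conversion are represented with de Bruijn indices; an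
    index pointing outside of all enclosing abstractions is a free variable. *)
Inductive term : Type :=
| Var (x : nat)
| Lam (t : term)
| App (t u : term).

Definition is_value (t : term) : bool :=
  if t is App _ _ then false else true.

Fixpoint occurs_free (x : nat) (t : term) : bool :=
  match t with
  | Var y => x == y
  | Lam t => occurs_free x.+1 t
  | App t u => occurs_free x t || occurs_free x u
  end.

Definition closed_term (t : term) : Prop := forall x, ~~ occurs_free x t.

Definition up_ren (r : nat -> nat) (x : nat) : nat :=
  if x is y.+1 then (r y).+1 else 0.

Fixpoint rename (r : nat -> nat) (t : term) : term :=
  match t with
  | Var x => Var (r x)
  | Lam t => Lam (rename (up_ren r) t)
  | App t u => App (rename r t) (rename r u)
  end.

Definition shift : term -> term := rename S.

Definition up_sub (s : nat -> term) (x : nat) : term :=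
  if x is y.+1 then shift (s y) else Var 0.

Fixpoint subst (s : nat -> term) (t : term) : term :=
  match t with
  | Var x => s x
  | Lam t => Lam (subst (up_sub s) t)
  | App t u => App (subst s t) (subst s u)
  end.

(** [t{v/x}], where [t] is the body of an abstraction binding [x] (index 0). *)
Definition subst1 (v t : term) : term :=
  subst (fun x => if x is y.+1 then Var y else v) t.

(** * Reduction *)

(** The side conditions of sigma_1 and sigma_3 on free variables are enforced
    by shifting the subterm that enters the scope of the abstraction. *)
Inductive root_beta : term -> term -> Prop :=
| RootBeta t v : is_value v -> root_beta (App (Lam t) v) (subst1 v t).

Inductive root_sigma : term -> term -> Prop :=
| RootSigma1 t u s :
    root_sigma (App (App (Lam t) u) s) (App (Lam (App t (shift s))) u)
| RootSigma3 v s u : is_value v ->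
    root_sigma (App v (App (Lam s) u)) (App (Lam (App (shift v) s)) u).

(** [BLam B t] is the context [(\x.B)t]; plugging a term in it may capture. *)
Inductive bctx : Type :=
| BHole
| BLam (B : bctx) (t : term)
| BAppL (B : bctx) (t : term)
| BAppR (t : term) (B : bctx).

Fixpoint plug (B : bctx) (t : term) : term :=
  match B with
  | BHole => t
  | BLam B u => App (Lam (plug B t)) u
  | BAppL B u => App (plug B t) u
  | BAppR u B => App u (plug B t)
  end.

Inductive bclosure (R : term -> term -> Prop) : term -> term -> Prop :=
| BClosure B t u : R t u -> bclosure R (plug B t) (plug B u).

Definition beta_step : term -> term -> Prop := bclosure root_beta.
Definition sigma_step : term -> term -> Prop := bclosure root_sigma.
Definition sh_step (t u : term) : Prop := beta_step t u \/ sigma_step t u.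

Definition normal_term (R : term -> term -> Prop) (t : term) : Prop :=
  forall u, ~ R t u.

Definition normalizable (R : term -> term -> Prop) (t : term) : Prop :=
  exists2 u, clos_refl_trans term R t u & normal_term R u.

(** [sh_reduces t n u]: there is a [sh_step]-reduction sequence from [t] to [u]
    with exactly [n] occurrences of [beta_step]. *)
Inductive sh_reduces : term -> nat -> term -> Prop :=
| ShRefl t : sh_reduces t 0 t
| ShBeta t t' n u :
    beta_step t t' -> sh_reduces t' n u -> sh_reduces t n.+1 u
| ShSigma t t' n u :
    sigma_step t t' -> sh_reduces t' n u -> sh_reduces t n u.

(** Graph of leng_{beta_v}, with [None] for infinity. Independence of the
    chosen sequence is part of what [leng t (Some n)] asserts. *)
Definition leng (t : term) (k : option nat) : Prop :=
  match k with
  | Some n =>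
      (exists2 u, sh_reduces t n u & normal_term sh_step u) /\
      (forall m u, sh_reduces t m u -> normal_term sh_step u -> m = n)
  | None => forall m u, sh_reduces t m u -> ~ normal_term sh_step u
  end.

(** * Types *)

(** The grammar  N ::= P -o Q,  P, Q ::= [N_1, ..., N_n]  asks for a type [neg]
    in bijection with [{mset neg} * {mset neg}], well-founded for membership.
    [{mset _}] cannot be nested in an inductive definition, so [neg] is carved
    out of trees whose lists of children are, hereditarily, the canonical
    enumerations of multisets. [larrow], [ldom], [lcod] with [larrowK_dom],
    [larrowK_cod], [larrow_eta] and [neg_ind] characterize it; the encoding is
    not used afterwards. *)
Inductive rneg : Type := RArr (P Q : seq rneg).

Fixpoint rneg_encode (r : rneg) : GenTree.tree unit :=
  let: RArr P Q := r in
  GenTree.Node 0 [:: GenTree.Node 0 (map rneg_encode P);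
                     GenTree.Node 0 (map rneg_encode Q)].

Fixpoint rneg_decode (g : GenTree.tree unit) : rneg :=
  if g is GenTree.Node _ [:: GenTree.Node _ P; GenTree.Node _ Q]
  then RArr (map rneg_decode P) (map rneg_decode Q) else RArr [::] [::].

Fixpoint rneg_nested_ind (X : rneg -> Prop)
    (H : forall P Q, (forall i, i < size P -> X (nth (RArr [::] [::]) P i)) ->
       (forall i, i < size Q -> X (nth (RArr [::] [::]) Q i)) -> X (RArr P Q))
    (r : rneg) : X r.
Proof.
case: r => P Q; apply: (H).
- elim: P => [|N P IH] [|i] //=; [move=> _; exact: (rneg_nested_ind X H) | exact: IH].
- elim: Q => [|N Q IH] [|i] //=; [move=> _; exact: (rneg_nested_ind X H) | exact: IH].
Qed.

Lemma rneg_encodeK : cancel rneg_encode rneg_decode.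
Proof.
elim/rneg_nested_ind => P Q IHP IHQ /=; rewrite -!map_comp.
congr RArr.
- apply: (@eq_from_nth _ (RArr [::] [::])); rewrite size_map // => i lt_i.
  by rewrite (nth_map (RArr [::] [::])) //= IHP.
- apply: (@eq_from_nth _ (RArr [::] [::])); rewrite size_map // => i lt_i.
  by rewrite (nth_map (RArr [::] [::])) //= IHQ.
Qed.

HB.instance Definition _ := Choice.copy rneg (can_type rneg_encodeK).

Fixpoint rneg_canonical (r : rneg) : bool :=
  let: RArr P Q := r in
  [&& all rneg_canonical P, all rneg_canonical Q,
      P == enum_mset (seq_mset P) & Q == enum_mset (seq_mset Q)].

Record neg : Type := Neg { rneg_of : rneg; _ : rneg_canonical rneg_of }.
HB.instance Definition _ := [isSub for rneg_of].
HB.instance Definition _ := [Choice of neg by <:].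

Definition pos : choiceType := {mset neg}.

Definition rneg_children (P : pos) : seq rneg :=
  enum_mset (seq_mset (map rneg_of (enum_mset P))).

Lemma perm_rneg_children (P : pos) :
  perm_eq (rneg_children P) (map rneg_of (enum_mset P)).
Proof. exact: perm_eq_seq_mset. Qed.

Lemma rneg_children_all (P : pos) : all rneg_canonical (rneg_children P).
Proof.
rewrite (perm_all _ (perm_rneg_children P)); apply/allP => r.
by case/mapP => -[r' cr'] _ ->.
Qed.

Lemma rneg_childrenK (P : pos) :
  rneg_children P = enum_mset (seq_mset (rneg_children P)).
Proof. by rewrite [in RHS]/rneg_children seq_mset_id. Qed.

Lemma larrow_subproof (P Q : pos) :
  rneg_canonical (RArr (rneg_children P) (rneg_children Q)).
Proof. by rewrite /= !rneg_children_all -!rneg_childrenK !eqxx. Qed.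

Definition larrow (P Q : pos) : neg := Neg (larrow_subproof P Q).

Notation "P ⊸ Q" := (larrow P Q) (at level 55, right associativity).

Definition ldom (N : neg) : pos :=
  let: RArr P _ := rneg_of N in seq_mset (pmap insub P).
Definition lcod (N : neg) : pos :=
  let: RArr _ Q := rneg_of N in seq_mset (pmap insub Q).

Lemma pmap_rneg_children (P : pos) :
  seq_mset (pmap insub (rneg_children P)) = P.
Proof.
rewrite -[RHS]seq_mset_id; apply/eq_seq_msetP.
rewrite (perm_trans (perm_pmap _ (perm_rneg_children P))) //.
by rewrite (map_pK valK).
Qed.

Lemma larrowK_dom P Q : ldom (P ⊸ Q) = P.
Proof. exact: pmap_rneg_children. Qed.

Lemma larrowK_cod P Q : lcod (P ⊸ Q) = Q.
Proof. exact: pmap_rneg_children. Qed.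

Lemma rneg_children_pmap (s : seq rneg) :
  all rneg_canonical s -> s == enum_mset (seq_mset s) ->
  rneg_children (seq_mset (pmap insub s)) = s.
Proof.
move=> cs /eqP def_s; rewrite [RHS]def_s /rneg_children; congr enum_mset.
apply/eq_seq_msetP; rewrite (perm_trans (perm_map _ (perm_eq_seq_mset _))) //.
have eq_f := eq_filter (isSome_insub neg).
by rewrite (pmap_filter (insubK neg)) eq_f (all_filterP cs).
Qed.

Lemma larrow_eta N : ldom N ⊸ lcod N = N.
Proof.
case: N => -[P Q] cN; apply: val_inj => /=.
case/and4P: (cN) => cP cQ eP eQ.
by rewrite /ldom /lcod /= !rneg_children_pmap.
Qed.

Lemma neg_ind (X : neg -> Prop) :
  (forall P Q : pos, (forall N, N \in (P : {mset neg}) -> X N) ->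
     (forall N, N \in (Q : {mset neg}) -> X N) -> X (P ⊸ Q)) ->
  forall N, X N.
Proof.
move=> H [r cr]; elim/rneg_nested_ind: r cr => P Q IHP IHQ cr.
rewrite -(larrow_eta (Neg cr)); apply: H => -[r' cr'].
- rewrite (perm_mem (perm_eq_seq_mset _)) mem_pmap_sub /= => r'P.
  move: cr'; rewrite -(nth_index (RArr [::] [::]) r'P) => cr'.
  by apply: IHP; rewrite index_mem.
- rewrite (perm_mem (perm_eq_seq_mset _)) mem_pmap_sub /= => r'Q.
  move: cr'; rewrite -(nth_index (RArr [::] [::]) r'Q) => cr'.
  by apply: IHQ; rewrite index_mem.
Qed.

(** * Type environments *)

Definition env : choiceType := {fsfun nat -> pos with mset0}.

Definition env0 : env := [fsfun].

Definition env1 (x : nat) (P : pos) : env := [fsfun env0 with x |-> P].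

Definition envD (G D : env) : env :=
  [fsfun x in (finsupp G `|` finsupp D)%fset => (G x `+` D x : pos)].

(** The environment [G, x : P], where [x] becomes index 0. *)
Definition env_cons (P : pos) (G : env) : env :=
  [fsfun x in (0 |` [fset y.+1 | y in finsupp G])%fset
     => (if x is y.+1 then G y else P)].

Lemma env0E x : env0 x = mset0.
Proof. by rewrite /env0 fsfunE. Qed.

Lemma env1E x P y : env1 x P y = if y == x then P else mset0.
Proof. by rewrite /env1 fsfun_withE env0E. Qed.

Lemma envDE (G D : env) x : envD G D x = G x `+` D x.
Proof.
rewrite fsfunE inE; case: ifPn => //; rewrite negb_or => /andP[].
by rewrite !memNfinsupp => /eqP-> /eqP->; rewrite msetD0.
Qed.

Lemma env_consE P (G : env) x :
  env_cons P G x = if x is y.+1 then G y else P.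
Proof.
rewrite fsfunE; case: ifPn => //; case: x => [|x]; rewrite !inE //=.
rewrite mem_imfset /=; last by move=> ? ? [].
by rewrite memNfinsupp => /eqP->.
Qed.

Lemma envDA : associative envD.
Proof. by move=> G D E; apply/fsfunP => x; rewrite !envDE msetDA. Qed.

Lemma envDC : commutative envD.
Proof. by move=> G D; apply/fsfunP => x; rewrite !envDE msetDC. Qed.

Lemma env0D : left_id env0 envD.
Proof. by move=> G; apply/fsfunP => x; rewrite envDE env0E msetDC msetD0. Qed.

HB.instance Definition _ := Monoid.isComLaw.Build env env0 envD envDA envDC env0D.

(** * Type derivations *)

Inductive deriv : env -> term -> pos -> Type :=
| DAx x P : deriv (env1 x P) (Var x) P
| DApp G D t u P Q :
    deriv G t [mset P ⊸ Q] -> deriv D u P -> deriv (envD G D) (App t u) Q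
| DLam n (G : 'I_n -> env) (P Q : 'I_n -> pos) t :
    (forall i, deriv (env_cons (P i) (G i)) t (Q i)) ->
    deriv (\big[envD/env0]_(i < n) G i) (Lam t)
          (seq_mset [seq P i ⊸ Q i | i : 'I_n]).

(** The number of (@) rules. *)
Fixpoint deriv_size G t P (pi : deriv G t P) : nat :=
  match pi with
  | DAx _ _ => 0
  | DApp _ _ _ _ _ _ pi1 pi2 => (deriv_size pi1 + deriv_size pi2).+1
  | DLam n _ _ _ _ pis => \sum_(i < n) deriv_size (pis i)
  end.

(* Main.v *)
(* A type derivation loses exactly one (@) rule along a balanced beta_v-step and
   none along a sigma-step: balanced contexts never enter an unapplied
   abstraction, so every redex is typed exactly once, and a value substituted
   for x splits its derivation among the occurrences of x without any (@) rule
   being created or lost. A term typed in the empty environment is either a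
   value or beta_v-reducible, and a value typed with 0 uses no (@) rule; hence
   every normalizing sequence from t spends all the |pi| rules, and
   beta_v-steps alone reach a value. *)

Require Import Defs.
From mathcomp Require Import all_boot finmap multiset.
From mathcomp Require Import zify.

Set Implicit Arguments.
Unset Strict Implicit.
Unset Printing Implicit Defensive.

Local Open Scope mset_scope.

Implicit Types (t u v : term) (P Q R : {mset neg}) (G D E : nat -> {mset neg}).

(** * Typing with a count of (@) rules *)

Definition scons P G (x : nat) : {mset neg} := if x is y.+1 then G y else P.

(* Environments are plain functions compared pointwise, and (λ) adds one arrow
   at a time, so that environments can be reindexed and typings of values split
   without big operators. The last argument counts the (@) rules. *)
Inductive typed : (nat -> {mset neg}) -> term -> {mset neg} -> nat -> Prop :=
| TVar G x P : (forall y, G y = if y == x then P else mset0) ->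
    typed G (Var x) P 0
| TApp G D E t u P Q n m :
    typed G t [mset P ⊸ Q] n -> typed D u P m ->
    (forall y, E y = G y `+` D y) -> typed E (App t u) Q (n + m).+1
| TLam0 G t : (forall y, G y = mset0) -> typed G (Lam t) mset0 0
| TLamS G D E t P Q R n m :
    typed (scons P G) t Q n -> typed D (Lam t) R m ->
    (forall y, E y = G y `+` D y) ->
    typed E (Lam t) ((P ⊸ Q) +` R) (n + m).

Lemma typed_ext G E t P n : typed G t P n -> G =1 E -> typed E t P n.
Proof.
move=> T; elim: T E => {G t P n}.
- by move=> G x P HG E GE; apply: TVar => y; rewrite -GE.
- move=> G D E t u P Q n m Tt _ Tu _ HE E' EE'.
  by apply: TApp Tt Tu _ => y; rewrite -EE'.
- by move=> G t HG E GE; apply: TLam0 => y; rewrite -GE.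
- move=> G D E t P Q R n m Tt _ Tu _ HE E' EE'.
  by apply: TLamS Tt Tu _ => y; rewrite -EE'.
Qed.

(** * Inversion, and the typing of values *)

Lemma typed_app_inv E t u Q k : typed E (App t u) Q k ->
  exists P G D n m, [/\ typed G t [mset P ⊸ Q] n, typed D u P m,
    forall y, E y = G y `+` D y & k = (n + m).+1].
Proof.
move ew : (App t u) => w T.
case: T ew => // G D {}E t' u' P Q' n m Tt Tu HE [-> ->].
by exists P, G, D, n, m.
Qed.

(** [TLamS] always leaves an arrow in the type, so only an axiom at 0 or [TLam0] remains. *)
Lemma typed_value0 G v n : is_value v -> typed G v mset0 n ->
  (forall y, G y = mset0) /\ n = 0.
Proof.
move=> vv; move: {2 3}mset0 (erefl (mset0 : {mset neg})) => Z eZ T.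
case: T vv eZ => //.
- by move=> {}G x P HG _ eP; split=> // y; rewrite HG -eP if_same.
- move=> {}G D E t P Q R k m _ _ _ _ /msetP/(_ (P ⊸ Q)).
  by rewrite mset1DE eqxx mset0E.
Qed.

Lemma typed_lam1 G t P Q n :
  typed (scons P G) t Q n -> typed G (Lam t) [mset P ⊸ Q] n.
Proof.
move=> T; rewrite -(addn0 n) -(msetD0 [mset _]).
apply: TLamS T (TLam0 (G := fun=> mset0) t (fun=> erefl)) _ => y.
by rewrite msetD0.
Qed.

(** Counting arrows in a singleton leaves exactly one [TLamS]; the rest has type 0 and adds neither
    assumptions nor (@) rules. *)
Lemma typed_lam1_inv E t P Q n : typed E (Lam t) [mset P ⊸ Q] n ->
  typed (scons P E) t Q n.
Proof.
move ew : (Lam t) => w; move eZ : [mset P ⊸ Q] => Z T.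
case: T ew eZ => //.
- by move=> G t' _ _ /msetP/(_ (P ⊸ Q)); rewrite msetnxx mset0E.
move=> G D {}E t' P' Q' R k m Tt Tu HE [et] eZ; subst t'.
have eN : P' ⊸ Q' = P ⊸ Q.
  apply/eqP; move/msetP/(_ (P' ⊸ Q')): eZ.
  by rewrite msetnE mset1DE eqxx; case: eqP.
have eR : R = mset0.
  apply/msetP => a; move/msetP/(_ a): eZ.
  rewrite mset1DE eN msetnE mset0E; case: eqP => _; lia.
have eP : P' = P by rewrite -(larrowK_dom P' Q') eN larrowK_dom.
have eQ : Q' = Q by rewrite -(larrowK_cod P' Q') eN larrowK_cod.
subst; case: (typed_value0 _ Tu) => // HD ->; rewrite addn0.
by apply: typed_ext Tt _ => -[|y] //=; rewrite HE HD msetD0.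
Qed.

(** Abstractions are typed arrow by arrow: the arrow added last lies in [P] or in [Q], and its
    premise goes to that side. Derivations of applications do not split this way. *)
Lemma typed_value_split E v P Q n : is_value v -> typed E v (P `+` Q) n ->
  exists G D k m, [/\ typed G v P k, typed D v Q m,
    forall y, E y = G y `+` D y & n = k + m].
Proof.
move=> vv; move eZ : (P `+` Q) => Z T.
elim: T vv P Q eZ => {E v Z n} //.
- move=> G x Z HG _ P Q eZ.
  exists (fun y => if y == x then P else mset0).
  exists (fun y => if y == x then Q else mset0), 0, 0; split=> //.
  + exact: TVar.
  + exact: TVar.
  + by move=> y; rewrite HG -eZ; case: eqP => // _; rewrite msetD0.
- move=> G t HG _ P Q eZ.
  have [-> ->] : P = mset0 /\ Q = mset0.
    split; apply/msetP => a; move/msetP/(_ a): eZ; rewrite msetE2 !mset0E; lia.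
  exists (fun=> mset0), (fun=> mset0), 0, 0; split=> //; try exact: TLam0.
  by move=> y; rewrite HG msetD0.
move=> G D E t P1 Q1 R n m Tt _ Tu IH HE _ P Q eZ.
have : P1 ⊸ Q1 \in P `+` Q by rewrite eZ mset1D1.
case/msetDP => inZ.
- have eR : (P `\ (P1 ⊸ Q1)) `+` Q = R.
    rewrite -(msetD1K (P1 ⊸ Q1) R) -eZ -{2}(msetB1K inZ).
    by rewrite -msetDA msetD1K.
  have [G1 [D1 [k1 [m1 [T1 T2 HD ->]]]]] := IH isT _ _ eR.
  exists (fun y => G y `+` G1 y), D1, (n + k1), m1; split=> //; last lia.
    by rewrite -(msetB1K inZ); apply: TLamS Tt T1 _.
  by move=> y; rewrite HE HD msetDA.
- have eR : P `+` (Q `\ (P1 ⊸ Q1)) = R.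
    rewrite -(msetD1K (P1 ⊸ Q1) R) -eZ -{2}(msetB1K inZ).
    by rewrite msetDCA msetD1K.
  have [G1 [D1 [k1 [m1 [T1 T2 HD ->]]]]] := IH isT _ _ eR.
  exists G1, (fun y => G y `+` D1 y), k1, (n + m1); split=> //; last lia.
    by rewrite -(msetB1K inZ); apply: TLamS Tt T2 _.
  by move=> y; rewrite HE HD msetDCA.
Qed.

(** * Renaming and substitution *)

Lemma unbump_eq k x y : y != k -> (unbump k y == x) = (y == bump k x).
Proof.
rewrite /bump /unbump => neq_yk; apply/eqP/eqP; case: ltnP; case: leqP; lia.
Qed.

(** Weakening of an environment: a fresh index [k] of type 0, the indices from [k] on being raised
    by one. *)
Definition insert0 k G (y : nat) : {mset neg} :=
  if y == k then mset0 else G (unbump k y).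

Lemma insert0D k G D E : (forall y, E y = G y `+` D y) ->
  forall y, insert0 k E y = insert0 k G y `+` insert0 k D y.
Proof. by move=> HE y; rewrite /insert0; case: eqP; rewrite ?msetD0. Qed.

Lemma insert0_scons k P G : insert0 k.+1 (scons P G) =1 scons P (insert0 k G).
Proof. by case=> [|y] //; rewrite /insert0 unbumpS. Qed.

(** [k] is arbitrary for passage under binders, and [r] is given pointwise because lifting [bump k]
    yields [bump k.+1] only extensionally. *)
Lemma typed_rename k r G t P n : r =1 bump k -> typed G t P n ->
  typed (insert0 k G) (rename r t) P n.
Proof.
move=> Hr T; elim: T k r Hr => {G t P n} /=.
- move=> G x P HG k r Hr; apply: TVar => y; rewrite /insert0 Hr HG.
  case: eqP => [->|/eqP neq_yk].
    by rewrite (negPf (neq_bump k x)).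
  by rewrite unbump_eq.
- move=> G D E t u P Q n m _ IHt _ IHu HE k r Hr.
  exact: TApp (IHt _ _ Hr) (IHu _ _ Hr) (insert0D _ HE).
- by move=> G t HG k r _; apply: TLam0 => y; rewrite /insert0 HG if_same.
- move=> G D E t P Q R n m _ IHt _ IHu HE k r Hr.
  apply: (TLamS (G := insert0 k G)) (IHu _ _ Hr) (insert0D _ HE).
  apply: typed_ext (IHt k.+1 _ _) (@insert0_scons k P G).
  by case=> [|x] //=; rewrite Hr bumpS.
Qed.

Lemma typed_shift G t P n :
  typed G t P n -> typed (scons mset0 G) (shift t) P n.
Proof.
move=> T; apply: typed_ext (typed_rename (k := 0) _ T) _ => //.
by case=> [|y] //; rewrite /insert0 /= /unbump subn1.
Qed.

Lemma is_value_shift v : is_value (shift v) = is_value v.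
Proof. by case: v. Qed.

(** The derivation of [v] is split between the premises of each rule. An axiom on [k] consumes its
    share whole; at any other leaf the share has type 0, hence no (@) rule, so the counts add up
    exactly. *)
Lemma typed_subst k s v G D t Q n m :
  (forall x, s x = if x == k then v else Var (unbump k x)) -> is_value v ->
  typed G t Q n -> typed D v (G k) m ->
  typed (fun y => G (bump k y) `+` D y) (subst s t) Q (n + m).
Proof.
move=> Hs vv T; elim: T k s v D m Hs vv => {G t Q n} /=.
- move=> G x P HG k s v D m Hs vv; rewrite Hs HG eq_sym.
  case: eqP => [<-|/eqP neq_kx] Tv.
    apply: typed_ext Tv _ => y.
    by rewrite HG eq_sym (negPf (neq_bump _ _)) mset0D.
  have [HD ->] := typed_value0 vv Tv.
  by apply: TVar => y; rewrite HG HD msetD0 eq_sym -unbump_eq // eq_sym.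
- move=> G D1 E t u P Q n m1 _ IHt _ IHu HE k s v D m Hs vv.
  rewrite HE => /(typed_value_split vv)[Da [Db [ma [mb [Ta Tb HD ->]]]]].
  rewrite (_ : _ + _ = (n + ma + (m1 + mb)).+1); last lia.
  apply: TApp (IHt _ _ _ _ _ Hs vv Ta) (IHu _ _ _ _ _ Hs vv Tb) _ => y.
  by rewrite HE HD msetDACA.
- move=> G t HG k s v D m _ vv; rewrite HG => /(typed_value0 vv)[HD ->].
  by apply: TLam0 => y; rewrite HG HD msetD0.
- move=> G D1 E t P Q R n m1 _ IHt _ IHu HE k s v D m Hs vv.
  rewrite HE => /(typed_value_split vv)[Da [Db [ma [mb [Ta Tb HD ->]]]]].
  rewrite (_ : _ + _ = n + ma + (m1 + mb)); last lia.
  apply: (TLamS (G := fun y => G (bump k y) `+` Da y))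
    (IHu _ _ _ _ _ Hs vv Tb) _; last first.
    by move=> y; rewrite HE HD msetDACA.
  (* Under the binder [v] is shifted, so it requires only type 0 of the bound variable. *)
  apply: typed_ext (IHt k.+1 _ (shift v) (scons mset0 Da) ma _ _ _) _.
  + by case=> [|x] //=; rewrite Hs unbumpS eqSS; case: eqP.
  + by rewrite is_value_shift.
  + exact: typed_shift.
  + by case=> [|y] /=; rewrite ?bumpS //= msetD0.
Qed.

(** * Subject reduction with exact counts *)

(** A function position has a singleton type, so the body of an applied abstraction is typed exactly
    once; the (@) lost is that of the redex. *)
Lemma typed_beta t u G P n : beta_step t u -> typed G t P n ->
  exists2 m, n = m.+1 & typed G u P m.
Proof.
case=> B {}t {}u; case=> {}t v vv.
elim: B G P n => [|B IH s|B IH s|s B IH] G P n /= /typed_app_inv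
  [Q [G1 [G2 [n1 [n2 [T1 T2 HG ->]]]]]].
- exists (n1 + n2) => //.
  have T0 := typed_lam1_inv T1.
  apply: typed_ext (typed_subst (k := 0) (v := v) (D := G2) _ vv T0 T2) _ => y.
    by case: y => [|y] //; rewrite /unbump /= subn1.
  by rewrite HG.
- have [m -> T] := IH _ _ _ (typed_lam1_inv T1).
  exists (m + n2).+1 => //; exact: TApp (typed_lam1 T) T2 HG.
- have [m -> T] := IH _ _ _ T1.
  exists (m + n2).+1 => //; exact: TApp T T2 HG.
- have [m -> T] := IH _ _ _ T2; exists (n1 + m).+1; first by rewrite addnS.
  exact: TApp T1 T HG.
Qed.

(** The same premises are regrouped under two (@) rules; the shifted subterm crosses the binder with
    type 0 for the bound variable. *)
Lemma typed_sigma t u G P n : sigma_step t u -> typed G t P n -> typed G u P n.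
Proof.
case=> B {}t {}u root.
have inv := typed_app_inv; elim: B G P n => [|B IH s|B IH s|s B IH] G P n /=.
- case: root => [{}t {}u s|v s {}u vv]
    /inv[Q [G1 [G2 [n1 [n2 [T1 T2 HG ->]]]]]].
  + case/inv: T1 => [R [D1 [D2 [m1 [m2 [T1 T3 HD ->]]]]]].
    rewrite (_ : _.+1 = ((m1 + n2).+1 + m2).+1); last lia.
    apply: (TApp (G := fun y => D1 y `+` G2 y) (D := D2)) T3 _; last first.
      by move=> y; rewrite HG HD msetDAC.
    apply: typed_lam1; apply: TApp (typed_lam1_inv T1) (typed_shift T2) _.
    by case=> [|y] //=; rewrite msetD0.
  + case/inv: T2 => [R [D1 [D2 [m1 [m2 [T2 T3 HD ->]]]]]].
    rewrite (_ : _.+1 = ((n1 + m1).+1 + m2).+1); last lia.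
    apply: (TApp (G := fun y => G1 y `+` D1 y) (D := D2)) T3 _; last first.
      by move=> y; rewrite HG HD msetDA.
    apply: typed_lam1; apply: TApp (typed_shift T1) (typed_lam1_inv T2) _.
    by case=> [|y] //=; rewrite mset0D.
- case/inv=> [Q [G1 [G2 [n1 [n2 [T1 T2 HG ->]]]]]].
  exact: TApp (typed_lam1 (IH _ _ _ (typed_lam1_inv T1))) T2 HG.
- case/inv=> [Q [G1 [G2 [n1 [n2 [T1 T2 HG ->]]]]]].
  exact: TApp (IH _ _ _ T1) T2 HG.
- case/inv=> [Q [G1 [G2 [n1 [n2 [T1 T2 HG ->]]]]]].
  exact: TApp T1 (IH _ _ _ T2) HG.
Qed.

(** * Progress and normal forms *)

(** Both subterms inherit the empty environment, which gives variables only type 0, whereas a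
    function position demands a singleton. The function is thus an abstraction or, by induction,
    reducible. *)
Lemma typed_app_beta G t u P n : (forall y, G y = mset0) ->
  typed G (App t u) P n -> exists s, beta_step (App t u) s.
Proof.
move eq_w : (App t u) => w HG T; elim: T t u HG eq_w => // {G w P n}.
move=> G D E t u P Q n m Tt IHt _ IHu HE _ _ HE0 _.
have HGD y : G y = mset0 /\ D y = mset0.
  split; apply/msetP => a; move/msetP/(_ a): (HE y);
  rewrite HE0 msetE2 !mset0E; lia.
have HG y : G y = mset0 by case: (HGD y).
have HD y : D y = mset0 by case: (HGD y).
case: t Tt IHt => [x|t|t1 t2] Tt IHt.
- exfalso; move: Tt; move ew : (Var x) => w; move eZ : [mset _] => Z T.
  case: T ew eZ HG => // G0 z R HR _ eZ /(_ z).
  by rewrite HR eqxx -eZ => /msetP/(_ (P ⊸ Q)); rewrite msetnxx mset0E.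
- case: (boolP (is_value u)) => [vu|].
    by exists (subst1 u t); apply: (BClosure BHole).
  case: u IHu => // u1 u2 IHu _.
  have [_ [B r s rs]] := IHu _ _ HD erefl.
  by exists (plug (BAppR (Lam t) B) s); apply: (BClosure (BAppR (Lam t) B)).
- have [s] := IHt _ _ HG erefl.
  move ew : (App t1 t2) => w [B r s' rs].
  by exists (plug (BAppL B u) s'); apply: (BClosure (BAppL B u)).
Qed.

(** Redexes and nonempty balanced contexts are all applications at the root. *)
Lemma value_sh_normal v : is_value v -> normal_term sh_step v.
Proof.
by move=> vv u [] st; case: st vv => -[|????|???|???] // ? ? [].
Qed.

Lemma sh_normal_value G t P n : (forall y, G y = mset0) ->
  typed G t P n -> normal_term sh_step t -> is_value t.
Proof.
case: t => // t u HG T nf; case: (typed_app_beta HG T) => s st.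
by case: (nf s); left.
Qed.

(** Progress provides a beta-step until a value is reached; each step lowers the count by one, and a
    value of type 0 has count 0. *)
Lemma typed_sh_normalizes G t n : (forall y, G y = mset0) ->
  typed G t mset0 n -> exists2 u, sh_reduces t n u & normal_term sh_step u.
Proof.
move=> HG; elim: n t => [|n IH] t T.
  exists t; first exact: ShRefl.
  case: t T => [x|t|t u] T; [exact: value_sh_normal..|].
  have [s st] := typed_app_beta HG T.
  by have [] := typed_beta st T.
case: (boolP (is_value t)) => [vt|]; first by have [] := typed_value0 vt T.
case: t T => // t u T _.
have [s st] := typed_app_beta HG T.
have [m [<-] Ts] := typed_beta st T.
by have [r red nf] := IH _ Ts; exists r => //; apply: ShBeta st red.
Qed.

(** * Derivation size and reduction length *)

Lemma typed_sh_reduces G t u P n m : sh_reduces t m u -> typed G t P n ->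
  exists2 k, n = m + k & typed G u P k.
Proof.
move=> red; elim: red n => {t m u}.
- by move=> t n T; exists n.
- move=> t t' m u st _ IH n /(typed_beta st)[n' -> T].
  by have [k -> Tu] := IH _ T; exists k.
- by move=> t t' m u st _ IH n /(typed_sigma st); apply: IH.
Qed.

Lemma deriv_typed (G : env) t (P : pos) (pi : deriv G t P) :
  typed G t P (deriv_size pi).
Proof.
elim: pi => {G t P} /=.
- by move=> x P; apply: TVar => y; rewrite env1E.
- move=> G D t u P Q pi1 IH1 pi2 IH2.
  by apply: TApp IH1 IH2 _ => y; rewrite envDE.
(* The environment, the type and the count are put over the same list [enum 'I_n], so one induction
   unfolds the n-ary rule into [TLamS] steps. *)
- move=> n G P Q t pis IH; rewrite /image_mem -!big_enum.
  elim: (enum 'I_n) => [|i s IHs] /=.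
    rewrite !big_nil; have -> : seq_mset [::] = mset0 :> {mset neg}.
      by apply/msetP => a; rewrite mset_seqE mset0E.
    by apply: TLam0 => y; rewrite env0E.
  rewrite !big_cons.
  have -> N (r : seq neg) : seq_mset (N :: r) = N +` seq_mset r.
    by apply/msetP => a; rewrite mset1DE !mset_seqE /= eq_sym.
  apply: (TLamS (G := G i)) IHs _; last by move=> y; rewrite envDE.
  by apply: typed_ext (IH i) _ => y; rewrite env_consE.
Qed.

Theorem theorem6p3 (t : term) (t_closed : closed_term t)
    (t_norm : normalizable beta_step t) (pi : deriv env0 t mset0) :
  leng t (Some (deriv_size pi)).
Proof.
have T := deriv_typed pi; split; first exact: (typed_sh_normalizes env0E T).
move=> m u red nf; have [k -> Tu] := typed_sh_reduces red T.
(* [k] counts the (@) rules left in the normal form, a value of type 0; hence it vanishes. *)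
have [_ ->] := typed_value0 (sh_normal_value env0E Tu nf) Tu.
by rewrite addn0.
Qed.
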